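(* Let $n$, $k$ and $r$ be integers such that $1<r<k<n$. Then \[ \lfloor (rn-1)/k\rfloor-1 \leq \sigma(n,k,r)\leq \lfloor (rn-1)/k\rfloor, \] where $\sigma(n,k,r)$ denotes the largest integer $s\in[0,n]$ such that there exists an $(s,k,r)$-clash-free permutation of $\mathbb{Z}_n$.
   Context: For integers $u\leq v$, $[u,v]$ denotes the set of integers $i$ with $u\leq i\leq v$. For a subset $X\subseteq\mathbb{Z}_n$, define $||X||_n=\min\{t\in\mathbb{Z}\mid X\subseteq x+[0,t]\bmod n \text{ for some } x\in\mathbb{Z}_n\}$ (the minimum length of a cyclic interval containing $X$). For a permutation $\pi$ of $\mathbb{Z}_n$ and positive integers $s,k,r$, an $(s,k,r)$-clash is a subset $X\subseteq\mathbb{Z}_n$ of cardinality $r+1$ such that $||X||_n<s$ and $||\pi(X)||_n<k$. The permutation $\pi$ is $(s,k,r)$-clash-free if it has no $(s,k,r)$-clashes. *)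

(* Defs.v *)
(* Z_n is modelled by the ordinal type 'I_n with arithmetic mod n. *)
From mathcomp Require Import all_boot all_order all_fingroup.
Set Implicit Arguments. Unset Strict Implicit. Unset Printing Implicit Defensive.

Definition cyc_interval (n : nat) (x : 'I_n) (t : nat) : {set 'I_n} :=
  [set y : 'I_n | [exists i : 'I_n, (i <= t) && (val y == (x + i) %% n)]].

(* ||X||_n : the least t such that X is contained in some x + [0,t] mod n.
   For nonempty X, t = n-1 always works, so the minimum over t < n is the
   true minimum. *)
Definition cyc_norm (n : nat) (X : {set 'I_n}) : nat :=
  \big[minn/n]_(t < n | [exists x : 'I_n, X \subset cyc_interval x t]) t.

Definition clash (n : nat) (pi : {perm 'I_n}) (s k r : nat) (X : {set 'I_n}) : bool :=
  [&& #|X| == r.+1, cyc_norm X < s & cyc_norm (pi @: X) < k].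

Definition clash_free (n : nat) (pi : {perm 'I_n}) (s k r : nat) : bool :=
  [forall X : {set 'I_n}, ~~ clash pi s k r X].

(* sigma(n,k,r): the largest s in [0,n] admitting an (s,k,r)-clash-free
   permutation of Z_n (s = 0 always qualifies). *)
Definition sigma (n k r : nat) : nat :=
  \max_(s < n.+1 | [exists pi : {perm 'I_n}, clash_free pi s k r]) s.

(* Main.v *)
(** Upper bound: fix a window of [s] consecutive elements.  Its image has [s]
    elements, each lying in [k] of the [n] cyclic intervals of length [k], so
    clash-freeness gives [s * k <= r * n].  In case of equality every such
    interval meets the image in exactly [r] points; comparing the windows
    [[0, s-1]] and [[1, s]], an interval contains the image of [0] iff it
    contains the image of [s], which is impossible because [k < n].

    Lower bound: put [F = (r * n - 1) %/ k], [s = F - 1], [d = gcd(n, F)] and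
    [q = n / d].  Walk through the [d] cosets of [<F>] in [Z_n], of [q] points
    each, with steps [F] inside a coset, steps [F - 1] from a coset to the next,
    and one closing step [F + d - 1].  The inverse of this enumeration is
    clash-free: all steps are at least [s], so visits to an interval of length
    [s] happen in different turns around the circle, and [k] consecutive points
    make less than [r] turns because [F * k < r * n] improves to
    [F * k + d <= r * n] by divisibility. *)
Require Import Defs.
From mathcomp Require Import all_boot all_order all_fingroup.
From mathcomp Require Import zify.
Set Implicit Arguments. Unset Strict Implicit. Unset Printing Implicit Defensive.

(** * Cyclic intervals and the cyclic norm *)

Lemma modn_subK (n a y : nat) : a < n -> y < n -> (y + (a + n - y) %% n) %% n = a.
Proof.
move=> an yn; rewrite modnDmr.
have -> : y + (a + n - y) = a + n by lia.
by rewrite modnDr modn_small.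
Qed.

Lemma mem_cyc_interval (n : nat) (x y : 'I_n) (t : nat) :
  (y \in cyc_interval x t) = ((y + n - x) %% n <= t).
Proof.
have xn := ltn_ord x; have yn := ltn_ord y.
have n0 : 0 < n by lia.
rewrite inE; apply/existsP/idP => [[i /andP[it /eqP ->]]|yt].
  have H : x + (((x + i) %% n + n - x) %% n) = x + i %[mod n].
    by rewrite modn_subK ?ltn_mod // modn_mod.
  move/eqP: H; rewrite eqn_modDl modn_mod => /eqP ->.
  by rewrite modn_small.
exists (Ordinal (ltn_pmod (y + n - x) n0)) => /=.
by rewrite yt modn_subK ?eqxx.
Qed.

Lemma cyc_norm_leq (n : nat) (X : {set 'I_n}) (x : 'I_n) (t : nat) :
  t < n -> X \subset cyc_interval x t -> cyc_norm X <= t.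
Proof.
move=> tn sub; rewrite /cyc_norm.
have: Ordinal tn \in index_enum 'I_n by rewrite mem_index_enum.
elim: (index_enum _) => // u e IH; rewrite big_cons inE => /orP[/eqP <-|/IH le].
  by rewrite ifT ?geq_minl //; apply/existsP; exists x.
by case: ifP => // _; exact: leq_trans (geq_minr _ _) le.
Qed.

(** The default value [n] of the minimum is not below [s], so some actual interval witnesses the
    bound. *)
Lemma cyc_norm_ltP (n : nat) (X : {set 'I_n}) (s : nat) : s <= n ->
  cyc_norm X < s -> exists x : 'I_n, X \subset cyc_interval x s.-1.
Proof.
move=> sn; rewrite /cyc_norm; elim/big_rec: _ => [|t m /existsP[x sub] IH].
  by lia.
rewrite gtn_min => /orP[ts|/IH //].
exists x; apply: (subset_trans sub); apply/subsetP => y.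
by rewrite !mem_cyc_interval; lia.
Qed.

(** The reflection [y -> a - y] turns the starting points of such intervals into the offsets
    [0..t]. *)
Lemma card_cyc_interval_cover (n : nat) (a : 'I_n) (t : nat) : t < n ->
  #|[set y : 'I_n | a \in cyc_interval y t]| = t.+1.
Proof.
move=> tn; have n0 : 0 < n by lia.
pose f (y : 'I_n) := Ordinal (ltn_pmod (a + n - y) n0).
have fK : involutive f.
  move=> y; apply: val_inj => /=.
  have := modn_subK (ltn_ord a) (ltn_ord y).
  set z := (a + n - y) %% n; have zn : z < n by rewrite ltn_mod.
  move=> E; have : z + (a + n - z) %% n = z + y %[mod n].
    by rewrite modn_subK // addnC E.
  by move/eqP; rewrite eqn_modDl modn_mod => /eqP ->; rewrite modn_small.
have -> : [set y | a \in cyc_interval y t] = f @^-1: [set i : 'I_n | i <= t].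
  by apply/setP => y; rewrite !inE -mem_cyc_interval inE.
rewrite on_card_preimset; last first.
  by exists f => y _; rewrite fK.
have -> : [set i : 'I_n | i <= t] = [set widen_ord tn i | i : 'I_t.+1].
  apply/setP => i; rewrite inE; apply/idP/imsetP => [it|[j _ ->]].
    by exists (Ordinal (n:=t.+1) (m:=i) it) => //; apply: val_inj.
  by rewrite /= -ltnS.
rewrite card_imset ?card_ord // => i j /(congr1 val) /= ij; exact: val_inj.
Qed.

Lemma cyc_interval_separates (n : nat) (a b : 'I_n) (t : nat) :
  t.+1 < n -> a != b ->
  exists y, (a \in cyc_interval y t) != (b \in cyc_interval y t).
Proof.
move=> tn ab; have n0 : 0 < n by lia.
have bn := ltn_ord b; have an := ltn_ord a.
have bb : b \in cyc_interval b t.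
  by rewrite mem_cyc_interval addKn modnn.
case aB : (a \in cyc_interval b t); last by exists b; rewrite aB bb.
(* Moving the start from [b] to [b + 1] drops [b], whose offset becomes [n - 1 > t], and keeps
   [a]. *)
pose c := Ordinal (ltn_pmod b.+1 n0); exists c.
have E : forall z : 'I_n, (z + n - c) %% n = ((z + n - b) %% n + n.-1) %% n.
  move=> z; have zn := ltn_ord z; rewrite modnDml /=.
  have [lt|ge] := ltnP b.+1 n.
    rewrite (modn_small lt); have -> : z + n - b + n.-1 = z + n - b.+1 + n by lia.
    by rewrite modnDr.
  have -> : nat_of_ord b = n.-1 by lia.
  by rewrite prednK // modnn subn0 subnK //; lia.
rewrite !mem_cyc_interval !E addKn modnn add0n [n.-1 %% n]modn_small; last by lia.
move: aB; rewrite mem_cyc_interval; set m := (_ %% n) => mt.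
have m0 : 0 < m.
  rewrite lt0n; apply: contra ab => /eqP m0; apply/eqP/val_inj => /=.
  by have := modn_subK an bn; rewrite -/m m0 addn0 modn_small.
have -> : m + n.-1 = m.-1 + n by lia.
by rewrite modnDr modn_small; lia.
Qed.

(** * Upper bound by double counting *)

Section ClashFree.

Variables (n : nat) (pi : {perm 'I_n}) (s k r : nat).
Hypotheses (sn : s <= n) (kn : k < n) (k0 : 0 < k) (cf : clash_free pi s k r).

(** Any [r + 1] points of this set would form a clash. *)
Lemma clash_free_card (x y : 'I_n) (A : {set 'I_n}) :
  0 < s -> A \subset cyc_interval x s.-1 ->
  #|[set v in A | pi v \in cyc_interval y k.-1]| <= r.
Proof.
move=> s0 sub; set W := [set _ in A | _]; rewrite leqNgt; apply/negP => rW.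
have [X XW cX] : exists2 X : {set 'I_n}, X \subset W & #|X| = r.+1.
  have := rW; rewrite -bin_gt0 -(cards_draws W r.+1) card_gt0 => /set0Pn[X].
  by rewrite inE => /andP[XW /eqP cX]; exists X.
move/forallP/(_ X)/negP: cf; apply; rewrite /clash cX eqxx /=.
apply/andP; split.
  rewrite -(prednK s0) ltnS.
  apply: (@cyc_norm_leq _ _ x); first by lia.
  by apply: subset_trans sub; apply: (subset_trans XW); apply/subsetP => v; rewrite inE => /andP[].
rewrite -(prednK k0) ltnS.
apply: (@cyc_norm_leq _ _ y); first by lia.
apply/subsetP => _ /imsetP[v vX ->].
by have := subsetP XW v vX; rewrite inE => /andP[].
Qed.

Lemma sum_card_cyc_interval (A : {set 'I_n}) :
  \sum_(y : 'I_n) #|[set v in A | pi v \in cyc_interval y k.-1]| = #|A| * k.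
Proof.
under eq_bigr => y _ do rewrite -sum1_card.
rewrite (exchange_big_dep (mem A)) /=; last by move=> y v _; rewrite inE => /andP[].
rewrite -sum_nat_const; apply: eq_bigr => v vA.
rewrite sum1_card -[RHS](prednK k0) -(@card_cyc_interval_cover _ (pi v)); last by lia.
apply: eq_card => y; rewrite [RHS]in_set -[LHS]/(v \in [set _ in A | _]).
by rewrite in_set vA.
Qed.

(** Each of the [n] counts is at most [r], while their sum [s * k] is at least [r * n]. *)
Lemma clash_free_tight (x : 'I_n) (A : {set 'I_n}) :
  0 < s -> #|A| = s -> A \subset cyc_interval x s.-1 -> r * n <= s * k ->
  s * k = r * n /\
  forall y, #|[set v in A | pi v \in cyc_interval y k.-1]| = r.
Proof.
move=> s0 cA sub rnsk.
have le y : #|[set v in A | pi v \in cyc_interval y k.-1]| <= r.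
  exact: (clash_free_card y s0 sub).
have sumA := sum_card_cyc_interval A; rewrite cA in sumA.
have sumr : \sum_(y : 'I_n) r = r * n by rewrite sum_nat_const card_ord mulnC.
have [le1 eq1] := leqif_sum (fun (y : 'I_n) (_ : true) => leqif_geq (le y)).
rewrite sumA sumr in le1 eq1.
have E : s * k = r * n by apply/eqP; rewrite eqn_leq le1.
split=> // y; move: eq1; rewrite E eqxx => /esym/forall_inP/(_ y isT) ge.
by apply/eqP; rewrite eqn_leq le.
Qed.

Lemma clash_free_lt : r < k -> 0 < r -> s * k < r * n.
Proof.
move=> rk r0; rewrite ltnNge; apply/negP => rnsk.
have n0 : 0 < n by lia.
have s0 : 0 < s by rewrite lt0n; apply/eqP => s0; rewrite s0 mul0n in rnsk; nia.
have intervalE x t : x + t < n -> forall xn : x < n,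
    forall y : 'I_n, (y \in cyc_interval (Ordinal xn) t) = (x <= y <= x + t).
  move=> xt xn y; have yn := ltn_ord y; rewrite mem_cyc_interval /=.
  have [xy|yx] := leqP x y.
    have -> : y + n - x = y - x + n by lia.
    by rewrite modnDr modn_small; lia.
  by rewrite modn_small; lia.
have card_interval x t : x + t < n -> forall xn : x < n,
    #|cyc_interval (Ordinal xn) t| = t.+1.
  move=> xt xn.
  pose f (i : 'I_t.+1) : 'I_n := Ordinal (leq_ltn_trans (leq_add (leqnn x) (ltn_ord i : i <= t)) xt).
  have -> : cyc_interval (Ordinal xn) t = f @: 'I_t.+1.
    apply/setP => y; rewrite intervalE //; apply/idP/imsetP => [xy|[i _ ->]] /=.
      have yt : y - x < t.+1 by lia.
      by exists (Ordinal yt) => //; apply: val_inj => /=; lia.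
    by have := ltn_ord i; lia.
  rewrite card_imset ?card_ord // => i j /(congr1 val) /= ij; apply: val_inj => /=; lia.
have xs : 0 + s.-1 < n by lia.
have [E eq0] := clash_free_tight s0 (etrans (card_interval _ _ xs n0) (prednK s0)) (subxx _) rnsk.
(* If [s = n], equality would give [k = r]. *)
have sltn : s < n by rewrite ltn_neqAle sn andbT; apply/eqP => sE; rewrite sE in E; nia.
have n1 : 1 < n by lia.
have xs1 : 1 + s.-1 < n by lia.
have [_ eq1] := clash_free_tight s0 (etrans (card_interval _ _ xs1 n1) (prednK s0)) (subxx _) rnsk.
pose z0 := Ordinal n0; pose zs := Ordinal sltn.
have zz : pi z0 != pi zs by rewrite (inj_eq perm_inj) -val_eqE /=; lia.
have k1n : k.-1.+1 < n by lia.
have [y /negP] := cyc_interval_separates k1n zz; apply; apply/eqP.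
(* Removing [s] from one window and [0] from the other leaves [[1, s-1]] in both, so these parts
   cancel. *)
have := eq1 y; rewrite -(eq0 y) (cardsD1 zs) [RHS](cardsD1 z0).
move: (cyc_interval y k.-1) => J.
have setE (A : {set 'I_n}) (P : pred 'I_n) v : (v \in [set w in A | P w]) = (v \in A) && P v.
  by rewrite inE.
rewrite !setE !intervalE //=.
set B1 := (X in _ + #|pred_of_set X| = _); set B0 := (X in _ = _ + #|pred_of_set X|).
have -> : B1 = B0.
  apply/setP => v; rewrite !in_setD1 !setE !intervalE // -!val_eqE /=.
  by case: (pi v \in _); rewrite ?andbT ?andbF //; lia.
have -> : 0 < s <= 1 + s.-1 by lia.
by move/addIn; case: (pi z0 \in _); case: (pi zs \in _).
Qed.

End ClashFree.

(** * Lower bound by a walk through cosets *)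

(* [walk F q n i] is the [i]-th point of the walk, lifted to the line. *)
Definition walk (F q n i : nat) : nat := F * i - (i %% n) %/ q.

Section Walk.

Variables (F q n d : nat).
Hypotheses (F0 : 0 < F) (n0 : 0 < n) (nE : n = d * q).

Let q0 : 0 < q. Proof. by move: n0; rewrite nE muln_gt0 => /andP[]. Qed.

Lemma walkK (i : nat) : walk F q n i + (i %% n) %/ q = F * i.
Proof.
rewrite subnK //; apply: (leq_trans (leq_div _ _)); apply: (leq_trans (leq_mod _ _)).
by rewrite leq_pmull.
Qed.

Lemma coset_index_ltn (i : nat) : (i %% n) %/ q < d.
Proof. by rewrite ltn_divLR // -nE ltn_mod. Qed.

(** One time unit raises the coset index by at most one; wrapping around only lowers it. *)
Lemma coset_index_leq (i e : nat) : ((i + e) %% n) %/ q <= (i %% n) %/ q + e.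
Proof.
rewrite -modnDml; apply: (leq_trans (leq_div2r _ (leq_mod _ _))).
rewrite -ltnS ltn_divLR // mulSn mulnDl.
have := ltn_ceil (i %% n) q0; have := leq_pmulr e q0; lia.
Qed.

Lemma walk_step_geq (i e : nat) : walk F q n i + F.-1 * e <= walk F q n (i + e).
Proof.
have := walkK i; have := walkK (i + e); have := coset_index_leq i e.
have : F * (i + e) = F * i + F.-1 * e + e by rewrite -{1 2}(prednK F0); lia.
lia.
Qed.

Lemma walk_step_leq (i e : nat) : walk F q n (i + e) < walk F q n i + F * e + d.
Proof.
have := walkK i; have := walkK (i + e); have := coset_index_ltn i.
by rewrite mulnDr; move: (_ %/ q) (_ %/ q) => c c1; lia.
Qed.

Lemma walk_modn (i : nat) : walk F q n (i %% n) = walk F q n i %[mod n].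
Proof.
have H1 := walkK (i %% n); have H2 := walkK i; rewrite modn_mod in H1.
have E : F * i = F * (i %% n) + F * (i %/ n) * n by rewrite {1}(divn_eq i n); lia.
have -> : walk F q n i = F * (i %/ n) * n + walk F q n (i %% n) by lia.
by rewrite modnMDl.
Qed.

(** Reduction modulo [d], which divides [F] and [n], recovers the coset index; within a coset, [q]
    divides [j - i < q]. *)
Lemma walk_inj (i j : nat) : d = gcdn n F -> i < n -> j < n ->
  walk F q n i = walk F q n j %[mod n] -> i = j.
Proof.
move=> dE; wlog ij : i j / i <= j.
  by move=> W ni nj E; have [/W|/ltnW/W] := leqP i j; [|move=> H; apply/esym]; auto.
move=> ni nj E.
have H1 := walkK i; have H2 := walkK j; rewrite !modn_small // in H1 H2.
have Em : F * i + j %/ q = F * j + i %/ q %[mod n].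
  rewrite -H1 -H2 -!addnA -modnDml E modnDml.
  by rewrite (addnC (i %/ q)).
have dn : d %| n by rewrite dE dvdn_gcdl.
have /dvdnP[g Fg] : d %| F by rewrite dE dvdn_gcdr.
have cE : j %/ q = i %/ q.
  have : j %/ q = i %/ q %[mod d].
    have := congr1 (modn^~ d) Em; rewrite /= !modn_dvdm // Fg.
    by rewrite -!mulnA !(mulnCA g) ![d * _]mulnC !modnMDl.
  by rewrite !modn_small // ltn_divLR // -nE.
move/eqP: Em; rewrite cE eqn_modDr eq_sym eqn_mod_dvd; last by rewrite leq_mul2l ij orbT.
rewrite -mulnBr {1}nE Fg (mulnC g) -mulnA dvdn_pmul2l; last by rewrite dE gcdn_gt0 n0.
(* [q = n / d] and [g = F / d] are coprime. *)
rewrite Gauss_dvdr; last first.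
  have d0 : 0 < d by rewrite dE gcdn_gt0 n0.
  by rewrite /coprime -(eqn_pmul2l d0) muln_gcdr -nE muln1 (mulnC d g) -Fg -dE.
move=> qd; apply/eqP; rewrite eqn_leq ij -subn_eq0.
have : j - i < q by have := divn_eq i q; have := divn_eq j q; have := ltn_pmod j q0; rewrite cE; lia.
by move=> lt; rewrite -(modn_small lt) -/(dvdn _ _) qd.
Qed.

End Walk.

Lemma exists_clash_free (n k r F : nat) :
  0 < F < n -> 0 < r -> 0 < k < n -> F * k < r * n ->
  exists pi : {perm 'I_n}, clash_free pi F.-1 k r.
Proof.
move=> /andP[F0 Fn] r0 /andP[k0 kn] Fk; have n0 : 0 < n by lia.
pose d := gcdn n F; pose q := n %/ d; pose L := walk F q n.
have nE : n = d * q by rewrite mulnC divnK ?dvdn_gcdl.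
have Fkd : F * k + d <= r * n.
  have /dvdnP[a aE] : d %| F * k by rewrite dvdn_mulr ?dvdn_gcdr.
  have /dvdnP[b bE] : d %| r * n by rewrite dvdn_mull ?dvdn_gcdl.
  by move: Fk; rewrite aE bE ltn_mul2r => /andP[_ ab]; rewrite -mulSnr leq_mul2r ab orbT.
pose a (i : 'I_n) : 'I_n := Ordinal (ltn_pmod (L i) n0).
have a_inj : injective a.
  move=> i j /(congr1 val) /= E; apply: val_inj.
  exact: (walk_inj F0 n0 nE (erefl _) (ltn_ord i) (ltn_ord j) E).
exists (perm a_inj)^-1%g; set pi := (_^-1)%g.
apply/forallP => X; apply/negP => /and3P[/eqP cX normX normY].
have F1 : 0 < F.-1 by apply: leq_ltn_trans normX.
have Fn1 : F.-1 <= n by lia.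
have [y /subsetP Xy] := cyc_norm_ltP Fn1 normX.
have [x /subsetP Xx] := cyc_norm_ltP (ltnW kn) normY.
have yn := ltn_ord y.
pose t (v : 'I_n) := (pi v + n - x) %% n.
(* [t v] is the time, counted from [x], at which the walk visits [v], and
   [b v] the number of the turn around the circle, counted from [y]. *)
pose b (v : 'I_n) := (L (x + t v) + n - y) %/ n.
(* [pi v] and [x + t v] agree modulo [n], and the walk is [n]-periodic on the circle. *)
have vE (v : 'I_n) : nat_of_ord v = L (x + t v) %% n.
  rewrite -[v in LHS](permKV (perm a_inj)) permE /= -/pi /L -[RHS](walk_modn F0 n0 nE).
  by rewrite modn_subK.
have tk v : v \in X -> t v <= k.-1.
  by move=> vX; have := Xx _ (imset_f pi vX); rewrite mem_cyc_interval.
have bE v : v \in X -> exists2 u, u <= F.-1.-1 & L (x + t v) + n = b v * n + u + y.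
  move=> vX; exists ((L (x + t v) + n - y) %% n); last first.
    by rewrite -divn_eq; lia.
  have := Xy _ vX; rewrite mem_cyc_interval -!addnBA ?(ltnW yn) //.
  by rewrite (vE v) modnDml.
(* Turn numbers modulo [r] will be distinct on the [r + 1] points of [X], against the pigeonhole
   principle. *)
have b_inj : {in X &, injective (fun v => Ordinal (ltn_pmod (b v) r0))}.
  move=> v w vX wX /(congr1 val) /=; wlog tvw : v w vX wX / t v <= t w.
    move=> W E; have [/W|/ltnW/W] := leqP (t v) (t w); first exact.
    by move=> H; apply/esym/H.
  have [u uF vb] := bE v vX; have [u' uF' wb] := bE w wX.
  have := tk _ wX; move: tvw; rewrite leq_eqVlt => /orP[/eqP tvw _ _|tvw twk].
    by apply: val_inj; rewrite /= (vE v) (vE w) tvw.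
  have e0 : 0 < t w - t v by rewrite subn_gt0.
  have xE : x + t w = x + t v + (t w - t v) by lia.
  have geq := walk_step_geq F0 n0 nE (x + t v) (t w - t v).
  have leq := walk_step_leq F0 n0 nE (x + t v) (t w - t v).
  rewrite -xE -/L in geq leq.
  have geq1 : F.-1 <= F.-1 * (t w - t v) by rewrite leq_pmulr.
  have leq1 : F * (t w - t v) + F <= F * k by rewrite -mulnSr leq_mul2l; lia.
  (* The walk advances by at least [F - 1], but offsets within the interval are at most [F - 2]. *)
  have lt_b : b v < b w.
    by rewrite ltnNge; apply/negP => bb; have := leq_mul bb (leqnn n); lia.
  (* The walk advances by less than [F * (k - 1) + d <= r * n - F]. *)
  have lt_r : b w < b v + r.
    rewrite ltnNge; apply/negP => bb; have := leq_mul bb (leqnn n).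
    by rewrite mulnDl; lia.
  move/eqP; rewrite eq_sym eqn_mod_dvd 1?ltnW // => /dvdn_leq.
  by lia.
have := max_card (mem [set Ordinal (ltn_pmod (b v) r0) | v in X]).
by rewrite card_in_imset // card_ord cX ltnn.
Qed.

Theorem theorem2 (n k r : nat) (h1r : 1 < r) (hrk : r < k) (hkn : k < n) :
  (r * n - 1) %/ k - 1 <= sigma n k r <= (r * n - 1) %/ k.
Proof.
have k0 : 0 < k by lia.
have rn0 : 0 < r * n by rewrite muln_gt0; lia.
apply/andP; split.
  set F := _ %/ k.
  have Fk : F * k < r * n by have := leq_divM (r * n - 1) k; rewrite -/F; lia.
  have F0 : 0 < F by rewrite divn_gt0 //; nia.
  (* [F * k < r * n < k * n]. *)
  have Fn : F < n by nia.
  have [||||pi cf] := @exists_clash_free n k r F; [lia|lia|lia|by []|].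
  have sn : F.-1 < n.+1 by lia.
  rewrite subn1; apply: (@leq_bigmax_cond _ _ _ (Ordinal sn)).
  by apply/existsP; exists pi.
apply/bigmax_leqP => s /existsP[pi cf]; rewrite leq_divRL //.
have := @clash_free_lt n pi s k r (ltn_ord s : s <= n) hkn k0 cf hrk; lia.
Qed.
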